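(* Let $n\ge 2$, let $\mathbf{A}$ be a degenerate $(n+1)$-simplex in $\mathbb{R}^n$ with vertices $A_1,\dots,A_{n+2}$ and non-degenerate $n$-faces, and let $\mathbf{B}$, with vertices $B_1,\dots,B_{n+2}$, be a dual of $\mathbf{A}$ in $\mathbb{R}^n$. Let $\alpha$ be a $1$-stress on $\mathbf{A}$ and $\beta$ a $1$-stress on $\mathbf{B}$. Then $c_{n-1}(\alpha^{n-1})=0$ if and only if $c_1(\beta^1)=0$, which is also equivalent to the vertices $B_1,\dots,B_{n+2}$ of $\mathbf{B}$ lying on an $(n-1)$-dimensional sphere in $\mathbb{R}^n$.
   Context: A degenerate $(n+1)$-simplex $\mathbf{A}$ in $\mathbb{R}^n$ (with non-degenerate $n$-faces) is given by $n+2$ points (vertices) $A_1,\dots,A_{n+2}\in\mathbb{R}^n$ any $n+1$ of which are affinely independent. A $1$-stress on $\mathbf{A}$ is a sequence $\alpha=\{\alpha_1,\dots,\alpha_{n+2}\}$ of non-zero reals with $\sum\alpha_iA_i=0$ and $\sum\alpha_i=0$; it exists and is unique up to a constant factor. Dual: a degenerate $(n+1)$-simplex $\mathbf{B}$ in $\mathbb{R}^n$ (with non-degenerate $n$-faces) with vertices $B_1,\dots,B_{n+2}$ is called a dual of $\mathbf{A}$ if $\overrightarrow{A_iA_j}\cdot\overrightarrow{B_kB_l}=0$ for all distinct $i,j,k,l\in\{1,\dots,n+2\}$. Stress invariants (Euclidean case): $c_0(\alpha^0)=1$, and for $1\le k\le n+1$ $$c_k(\alpha^k)=\sum_{S\subset\{1,\dots,n+2\},\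 |S|=k}\Big(\prod_{s\in S}\alpha_s\Big)\det\big(\overrightarrow{PA_s}\cdot\overrightarrow{QA_t}\big)_{s,t\in S},$$ for any points $P,Q\in\mathbb{R}^n$; the value does not depend on the choice of $P,Q$. The invariants $c_k(\beta^k)$ are defined in the same way from the points $B_i$ and the $1$-stress $\beta$ on $\mathbf{B}$. *)

(* Defs.v *)
From mathcomp Require Import all_boot all_order all_algebra.
From mathcomp Require Import reals.

Set Implicit Arguments.
Unset Strict Implicit.
Unset Printing Implicit Defensive.

Import Order.TTheory GRing.Theory Num.Theory.
Local Open Scope ring_scope.

Section StressInvariants.
Variables (R : realType) (n : nat).
Implicit Types (u v P Q : 'rV[R]_n) (A B : 'I_n.+2 -> 'rV[R]_n).

Definition dot u v : R := (u *m v^T) 0 0.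

(* The Euclidean distance; the norm that MathComp-Analysis puts on 'rV[R]_n is
   the sup norm. *)
Definition dist u v : R := Num.sqrt (dot (u - v) (u - v)).

Definition affinely_independent (I : finType) (S : {set I})
    (X : I -> 'rV[R]_n) : Prop :=
  forall c : I -> R,
    \sum_(i in S) c i = 0 -> \sum_(i in S) c i *: X i = 0 ->
    forall i, i \in S -> c i = 0.

(* A degenerate (n+1)-simplex in R^n with non-degenerate n-faces. *)
Definition degenerate_simplex A : Prop :=
  forall S : {set 'I_n.+2}, #|S| = n.+1 -> affinely_independent S A.

Definition is_stress A (alpha : 'I_n.+2 -> R) : Prop :=
  [/\ forall i, alpha i != 0,
      \sum_i alpha i *: A i = 0
    & \sum_i alpha i = 0].

Definition is_dual A B : Prop :=
  degenerate_simplex B /\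
  forall i j k l : 'I_n.+2, uniq [:: i; j; k; l] ->
    dot (A j - A i) (B l - B k) = 0.

(* The invariant c_k(alpha^k), computed from the base points P and Q. The rows
   and columns of the minor indexed by S are numbered by the enumeration of S.
   For k = 0 only the empty S contributes, and the value is 1. *)
Definition stress_invariant A (alpha : 'I_n.+2 -> R) P Q (k : nat) : R :=
  \sum_(S : {set 'I_n.+2} | #|S| == k)
    (\prod_(s in S) alpha s) *
    \det (\matrix_(i < #|S|, j < #|S|)
            dot (A (enum_val i) - P) (A (enum_val j) - Q)).

Definition cospherical B : Prop :=
  exists (O : 'rV[R]_n) (r : R), 0 < r /\ forall i, dist (B i) O = r.

End StressInvariants.

(* Main.v *)
Require Import Defs.
From mathcomp Require Import all_boot all_order all_algebra.
From mathcomp Require Import reals ring.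

(** Put the vertices of A in the rows of a matrix M_A, let D be the diagonal
    matrix of the 1-stress alpha, and consider the symmetric n x n matrix
    T_A = M_A^T D M_A = sum_i alpha_i A_i^T A_i.

    The invariant c_k(alpha^k) is the k-th elementary symmetric function of the
    eigenvalues of T_A, that is, the coefficient of X^k in det(1 + X T_A)
    [stress_invariant_coef]. Indeed c_k is the sum of the principal k-minors of
    D (M_A - 1 P)(M_A - 1 Q)^T, hence a coefficient of det(1 + X D ...)
    [coef_det_1addX]; Sylvester's identity det(1 + XY) = det(1 + YX)
    [det_1addmxC] turns this into an n x n determinant, from which the two
    stress equations remove P and Q [stress_tensor_translate].

    Duality makes T_A and T_B inverse to each other up to a scalar. The
    orthogonality relations and the stress equations force
      A_i . B_j = u_i + v_j + c [i = j] / alpha_i,    c <> 0   [dual_gram],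
    so that beta is a multiple of alpha [dual_stress] and
    T_A T_B is a nonzero scalar matrix [dual_tensor]. Since
    c_(n-1)(alpha) = det(T_A) tr(T_A^-1) [coef_pred_det_1addX], it vanishes
    exactly when tr T_B = c_1(beta) does.

    Finally c_1(beta) = sum_i beta_i |B_i - O|^2 for every point O
    [stress_tensor_trace], which is 0 if O is equidistant from all the B_i.
    Conversely, if it is 0, the formula for A_i . B_j gives an explicit
    equidistant point, a linear combination of the A_j
    [dual_equidistant]. *)

Set Implicit Arguments.
Unset Strict Implicit.
Unset Printing Implicit Defensive.

Import Order.TTheory GRing.Theory Num.Theory.
Local Open Scope ring_scope.

(** * Determinants and principal minors *)

(** Sylvester's identity: the two products of the block matrices
    [1, X; 0, 1] and [1, -X; Y, 1] are block triangular, with these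
    determinants. *)
Lemma det_1addmxC (R : comNzRingType) m n (X : 'M[R]_(m, n)) (Y : 'M[R]_(n, m)) :
  \det (1%:M + X *m Y) = \det (1%:M + Y *m X).
Proof.
pose E : 'M[R]_(m + n) := block_mx 1%:M X 0 1%:M.
pose F : 'M[R]_(m + n) := block_mx 1%:M (- X) Y 1%:M.
have EF : \det (E *m F) = \det (1%:M + X *m Y).
  rewrite mulmx_block !mul1mx !mulmx1 !mul0mx !add0r addNr.
  by rewrite det_lblock det1 mulr1.
have FE : \det (F *m E) = \det (1%:M + Y *m X).
  rewrite mulmx_block !mul1mx !mulmx1 !mulmx0 !addr0 addrN.
  by rewrite det_lblock det1 mul1r addrC.
by rewrite -EF -FE !det_mulmx mulrC.
Qed.

Definition principal_submx (R : Type) N (S : {set 'I_N}) (Z : 'M[R]_N) :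
    'M[R]_#|S| :=
  \matrix_(i, j) Z (enum_val i) (enum_val j).

(** A principal minor is the determinant of a matrix of full size, so that minors
    of different sizes can be added up inside one Leibniz formula. With E the
    matrix that selects the rows in S, the submatrix is 1 + E (Z - 1) E^T, and
    Sylvester's identity turns E E^T into the diagonal projection E^T E. *)
Lemma det_principal_minor (R : comNzRingType) N (Z : 'M[R]_N) (S : {set 'I_N}) :
  \det (principal_submx S Z) =
  \det (\matrix_(i, j) if i \in S then Z i j else (i == j)%:R).
Proof.
pose f : 'I_#|S| -> 'I_N := enum_val; pose E := rowsub f (1%:M : 'M[R]_N).
have EMr (M : 'M[R]_N) : E *m M *m E^T = mxsub f f M.
  by rewrite mul_rowsub_mx mul1mx trmx_mxsub trmx1 mulmx_colsub mulmx1 -mxsubcr.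
have EE : E^T *m E = diag_mx (\row_i (i \in S)%:R).
  apply/matrixP => i j; rewrite !mxE.
  under eq_bigr => k _ do rewrite !mxE.
  rewrite -(@big_enum_val _ _ _ _ (pred_of_set S)
    (fun k => (k == i)%:R * (k == j)%:R)) /=.
  case: (boolP (i \in S)) => iS.
    rewrite (bigD1 i) //= eqxx mul1r big1 ?addr0 // => k /andP[_ /negPf->].
    by rewrite mul0r.
  rewrite mul0rn big1 // => k kS.
  by case: eqP => [ki|]; rewrite ?mul0r // -ki kS in iS *.
have -> : principal_submx S Z = 1%:M + E *m (Z - 1%:M) *m E^T.
  apply/matrixP => i j; rewrite EMr !mxE (inj_eq enum_val_inj).
  by rewrite addrC subrK.
rewrite det_1addmxC mulmxA EE; congr (\det _).
apply/matrixP => i j; rewrite mul_diag_mx !mxE.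
by case: ifP => _; rewrite ?mul1r ?mul0r ?addr0 // addrC subrK.
Qed.

(** Each product in the Leibniz formula for 1 + Z expands over the set S of rows
    in which the entry of Z is chosen. *)
Lemma det_1addmx_minors (R : comNzRingType) N (Z : 'M[R]_N) :
  \det (1%:M + Z) =
  \sum_(S : {set 'I_N}) \det (principal_submx S Z).
Proof.
under eq_bigr => S _ do rewrite det_principal_minor.
rewrite exchange_big /=; apply: eq_bigr => s _; rewrite -mulr_sumr.
congr (_ * _); under eq_bigr => i _ do rewrite !mxE addrC.
rewrite bigA_distr.
by apply: eq_bigr => S _; apply: eq_bigr => i _; rewrite mxE.
Qed.

Lemma coef_det_1addX (R : comNzRingType) N (Z : 'M[R]_N) k :
  (\det (1%:M + 'X *: map_mx polyC Z))`_k =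
  \sum_(S : {set 'I_N} | #|S| == k) \det (principal_submx S Z).
Proof.
rewrite det_1addmx_minors coef_sum [RHS]big_mkcond /=; apply: eq_bigr => S _.
have -> : principal_submx S ('X *: map_mx polyC Z) =
    'X *: map_mx polyC (principal_submx S Z) by apply/matrixP=> i j; rewrite !mxE.
rewrite detZ det_map_mx coefMC coefXn eq_sym.
by case: eqP; rewrite ?mul1r ?mul0r.
Qed.

Lemma coef1_det_1addX (R : comNzRingType) N (Z : 'M[R]_N) :
  (\det (1%:M + 'X *: map_mx polyC Z))`_1 = \tr Z.
Proof.
rewrite coef_det_1addX big_cards1; apply: eq_bigr => i _.
rewrite /principal_submx.
move: enum_val (@enum_valP _ (pred_of_set [set i])).
rewrite cards1 => f fP; rewrite det_mx11 mxE.
by have := fP 0; rewrite inE => /eqP->.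
Qed.

(** The elementary symmetric function of degree n - 1 of the eigenvalues of T is
    det T times the trace of T^-1: multiplying 1 + X T by T' = T^-1 gives
    X + T', whose determinant is the characteristic polynomial of - T'. *)
Lemma coef_pred_det_1addX (F : fieldType) n (T T' : 'M[F]_n) :
  (0 < n)%N -> T *m T' = 1%:M ->
  (\det (1%:M + 'X *: map_mx polyC T))`_n.-1 * \det T' = \tr T'.
Proof.
move=> n_gt0 TT'.
rewrite -coefMC -det_map_mx -det_mulmx mulmxDl mul1mx -scalemxAl -map_mxM TT'.
rewrite map_mx1 scalemx1 addrC.
have -> : 'X%:M + map_mx polyC T' = char_poly_mx (- T').
  by rewrite /char_poly_mx map_mxN opprK.
by rewrite -/(char_poly _) char_poly_trace // linearN opprK.
Qed.

(** * The dot product *)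

Section Dot.
Variables (R : realType) (n : nat).
Implicit Types u v w : 'rV[R]_n.

Lemma dotE u v : dot u v = \sum_k u 0 k * v 0 k.
Proof. by rewrite /dot mxE; apply: eq_bigr => k _; rewrite mxE. Qed.

Lemma dotC u v : dot u v = dot v u.
Proof. by rewrite !dotE; apply: eq_bigr => k _; rewrite mulrC. Qed.

Lemma dotBl u v w : dot (u - v) w = dot u w - dot v w.
Proof. by rewrite /dot mulmxBl !mxE. Qed.

Lemma dotBr u v w : dot u (v - w) = dot u v - dot u w.
Proof. by rewrite dotC dotBl !(dotC u). Qed.

Lemma dot_suml (I : finType) (c : I -> R) (X : I -> 'rV[R]_n) w :
  dot (\sum_i c i *: X i) w = \sum_i c i * dot (X i) w.
Proof.
rewrite /dot mulmx_suml summxE; apply: eq_bigr => i _.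
by rewrite -scalemxAl mxE.
Qed.

Lemma dot_ge0 u : 0 <= dot u u.
Proof. by rewrite dotE sumr_ge0 // => k _; rewrite -expr2 sqr_ge0. Qed.

Lemma dot_eq0 u : (dot u u == 0) = (u == 0).
Proof.
apply/eqP/eqP => [|->]; last by rewrite /dot mul0mx mxE.
rewrite dotE => /psumr_eq0P u0; apply/rowP => k; rewrite mxE.
apply/eqP; rewrite -[_ == 0]orbb -mulf_eq0 u0 // => l _.
by rewrite -expr2 sqr_ge0.
Qed.
End Dot.

(** * The stress tensor *)

Section Points.
Variables (R : realType) (n : nat).
Implicit Types (A B : 'I_n.+2 -> 'rV[R]_n) (a : 'I_n.+2 -> R).

Definition vertex_mx A : 'M[R]_(n.+2, n) := \matrix_(i < n.+2) A i.
Definition ones : 'cV[R]_n.+2 := const_mx 1.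
Definition weights a : 'M[R]_n.+2 := diag_mx (\row_i a i).
Definition stress_tensor A a : 'M[R]_n :=
  (vertex_mx A)^T *m weights a *m vertex_mx A.

Lemma weights_tr a : (weights a)^T = weights a.
Proof. exact: tr_diag_mx. Qed.

Lemma weights_ones a : ones^T *m weights a = \row_i a i.
Proof. by apply/rowP => j; rewrite mul_mx_diag !mxE mul1r. Qed.

Lemma stress_vertex_mx A a : is_stress A a -> ones^T *m weights a *m vertex_mx A = 0.
Proof.
case=> _ <- _; rewrite weights_ones mulmx_sum_row.
by apply: eq_bigr => i _; rewrite mxE rowK.
Qed.

Lemma stress_ones A a : is_stress A a -> ones^T *m weights a *m ones = 0.
Proof.
case=> _ _ a0; rewrite weights_ones; apply/matrixP => i j; rewrite !mxE -[RHS]a0.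
by apply: eq_bigr => k _; rewrite !mxE mulr1.
Qed.

(** The two stress equations say that the rank-one corrections ones * P and
    ones * Q are killed by the weights. *)
Lemma stress_tensor_translate A a (P Q : 'rV[R]_n) : is_stress A a ->
  (vertex_mx A - ones *m Q)^T *m weights a *m (vertex_mx A - ones *m P) =
  stress_tensor A a.
Proof.
move=> sA; have [sp so] := (stress_vertex_mx sA, stress_ones sA).
have sp' : (vertex_mx A)^T *m weights a *m ones = 0.
  by apply: trmx_inj; rewrite !trmx_mul trmxK weights_tr mulmxA sp trmx0.
rewrite [(_ - _)^T]linearB /= trmx_mul mulmxBl mulmxBl
  !mulmxBr (mulmxA _ ones P) sp'.
rewrite -!(mulmxA Q^T) (mulmxA _ ones P) so sp !(mul0mx, mulmx0).
by rewrite !subr0.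
Qed.

(** The weights of the rows in S factor out of the minors of D M_P M_Q^T, whose
    sum is a coefficient of det(1 + X D M_P M_Q^T) = det(1 + X M_Q^T D M_P).
    The last matrix is free of P and Q, hence so is the invariant. *)
Lemma stress_invariant_coef A a (P Q : 'rV[R]_n) k : is_stress A a ->
  stress_invariant A a P Q k =
  (\det (1%:M + 'X *: map_mx polyC (stress_tensor A a)))`_k.
Proof.
move=> sA; rewrite -(stress_tensor_translate P Q sA).
pose MP := vertex_mx A - ones *m P; pose MQ := vertex_mx A - ones *m Q.
transitivity ((\det (1%:M + 'X *: map_mx polyC (weights a *m MP *m MQ^T)))`_k).
  rewrite coef_det_1addX; apply: eq_bigr => S _.
  pose f : 'I_#|S| -> 'I_n.+2 := enum_val.
  rewrite -mulmxA mul_diag_mx (big_enum_val (fun i => a i)) /=.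
  have -> : principal_submx S
        (\matrix_(i, j) ((\row_i a i) 0 i * (MP *m MQ^T) i j)) =
     diag_mx (\row_i a (f i)) *m principal_submx S (MP *m MQ^T).
    by rewrite mul_diag_mx; apply/matrixP => i j; rewrite !mxE.
  rewrite det_mulmx det_diag; congr (_ * _).
    by apply: eq_bigr => i _; rewrite mxE.
  congr (\det _); apply/matrixP => i j; rewrite /dot !mxE; apply: eq_bigr => l _.
  by rewrite !mxE !big_ord1 !mxE !mul1r.
rewrite [in LHS]map_mxM scalemxAl det_1addmxC -scalemxAr -map_mxM.
by rewrite -[MQ^T *m _ *m _]mulmxA.
Qed.

(** Moving the origin to O does not change the tensor, and the trace of X^T D X
    is the weighted sum of the squared lengths of the rows of X. *)
Lemma stress_tensor_trace A a (O : 'rV[R]_n) : is_stress A a ->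
  \tr (stress_tensor A a) = \sum_i a i * dot (A i - O) (A i - O).
Proof.
move=> sA; rewrite -(stress_tensor_translate O O sA) -mulmxA mxtrace_mulC.
apply: eq_bigr => i _; rewrite -mulmxA mul_diag_mx !mxE; congr (_ * _).
rewrite dotE; apply: eq_bigr => k _.
by rewrite !mxE big_ord1 !mxE mul1r.
Qed.
End Points.

(** * Affine spanning *)

Section Simplex.
Variables (R : realType) (n : nat).
Implicit Types (A B : 'I_n.+2 -> 'rV[R]_n) (a b : 'I_n.+2 -> R).

(** The vertices affinely span the space: a linear map that takes the same value
    z at all of them is zero. Already the n differences among the n + 1 vertices
    other than the first form an invertible matrix. *)
Lemma affine_const_on_vertices_eq0 A p (V : 'M[R]_(n, p)) (z : 'rV[R]_p) :
  degenerate_simplex A -> vertex_mx A *m V = ones R n *m z -> V = 0.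
Proof.
move=> dA AV.
pose L : 'M[R]_n :=
  \matrix_(i < n) (A (lift ord0 (lift ord0 i)) - A (lift ord0 ord0)).
have LV : L *m V = 0.
  have AVi i : A i *m V = z.
    have := congr1 (row i) AV; rewrite row_mul rowK => ->.
    by apply/rowP => j; rewrite !mxE big_ord1 !mxE mul1r.
  by apply/row_matrixP => i; rewrite row_mul rowK mulmxBl !AVi subrr row0.
suff uL : L \in unitmx by rewrite -(mulKmx uL V) LV mulmx0.
rewrite -row_free_unit -kermx_eq0; apply/eqP/row_matrixP => i; rewrite row0.
have := mulmx_ker L; move/(congr1 (row i)); rewrite row_mul row0.
move: (row i _) => r rL.
(* A relation r between the differences becomes an affine relation c between
   the vertices; the base vertex, subtracted everywhere, takes minus the sum. *)
pose c (k : 'I_n.+2) : R := if unlift ord0 k is Some k' then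
    (if unlift ord0 k' is Some k'' then r 0 k'' else - \sum_k r 0 k) else 0.
have cl k : c (lift ord0 (lift ord0 k)) = r 0 k by rewrite /c !liftK.
have c1 : c (lift ord0 ord0) = - \sum_k r 0 k by rewrite /c liftK unlift_none.
have /dA dAS : #|[set~ (ord0 : 'I_n.+2)]| = n.+1 by rewrite cardsC1 card_ord.
have sumS (M : nmodType) (h : 'I_n.+2 -> M) :
    \sum_(i in [set~ ord0]) h i = \sum_i h (lift ord0 i).
  rewrite big_mkcond big_ord_recl /= !inE eqxx add0r.
  by apply: eq_bigr => k _; rewrite !inE.
apply/rowP => k; rewrite mxE -cl; apply: dAS; last by rewrite !inE.
  by rewrite sumS big_ord_recl c1 (eq_bigr _ (fun k _ => cl k)) addNr.
rewrite sumS big_ord_recl c1 scaleNr scaler_suml -sumrN -big_split /= -[RHS]rL.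
rewrite mulmx_sum_row; apply: eq_bigr => l _; rewrite cl rowK scalerBr.
by rewrite addrC.
Qed.

(** The identity is a nonzero linear map, so it cannot be constant on the
    vertices. *)
Lemma simplex_vertices_differ A (O : 'rV[R]_n) :
  (0 < n)%N -> degenerate_simplex A -> ~ (forall i, A i = O).
Proof.
move=> n_gt0 dA AO.
have /matrixP/(_ (Ordinal n_gt0) (Ordinal n_gt0)) : 1%:M = 0 :> 'M[R]_n.
  apply: (affine_const_on_vertices_eq0 (z := O) dA); apply/row_matrixP => i.
  rewrite mulmx1 rowK AO; apply/rowP => j.
  by rewrite !mxE big_ord1 !mxE mul1r.
by rewrite !mxE eqxx => /eqP; rewrite oner_eq0.
Qed.
End Simplex.

(** * The dot products between a simplex and its dual *)

Lemma exists_notin (T : finType) (s : seq T) :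
  (size s < #|T|)%N -> exists p, p \notin s.
Proof.
move=> ltsT; apply/existsP; apply: contraLR ltsT => /existsPn s_all.
rewrite -leqNgt (leq_trans _ (card_size s)) // subset_leq_card //.
by apply/subsetP => p _; have := s_all p; rewrite negbK.
Qed.

(** For fixed j the function i |-> g i j - g i 0 is constant off {0, j}, by
    the quadrangle relations, and orthogonal to a; so it is a constant plus a
    multiple t_j of [i = j] / a_j - [i = 0] / a_0. Comparing columns j and k
    at the rows 0 and p, for a fourth index p, gives t_j = t_k. This is
    where n >= 2 is needed. *)
Lemma quadrangle_gram (F : fieldType) n (g : 'I_n.+2 -> 'I_n.+2 -> F)
    (a : 'I_n.+2 -> F) :
  (2 <= n)%N -> (forall i, a i != 0) -> \sum_i a i = 0 ->
  (forall j, \sum_i a i * g i j = 0) ->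
  (forall i j k l, uniq [:: i; j; k; l] ->
     g j l - g j k = g i l - g i k) ->
  exists c u v, forall i j, g i j = u i + v j + c * ((i == j)%:R / a i).
Proof.
move=> hn a0 sa sag quad.
pose e (i j : 'I_n.+2) : F := (i == j)%:R / a i.
have column j : exists mt : F * F, forall i,
    g i j - g i ord0 = mt.1 + mt.2 * (e i j - e i ord0).
  have [->|j0] := eqVneq j ord0.
    by exists (0, 0) => i; rewrite /= !subrr mul0r addr0.
  have [p] : exists p, p \notin [:: ord0; j].
    by apply: exists_notin; rewrite card_ord ltnW.
  rewrite !inE negb_or => /andP[p0 pj].
  set m := g p j - g p ord0; pose t := (g j j - g j ord0 - m) * a j.
  have generic i : i != ord0 -> i != j -> g i j - g i ord0 = m.
    move=> i0 ij; have [->//|ip] := eqVneq i p.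
    by apply: quad; rewrite /= !inE !negb_or eq_sym ip p0 pj i0 ij eq_sym j0.
  have : \sum_i a i * (g i j - g i ord0 - m) = 0.
    under eq_bigr => i _ do rewrite !mulrBr.
    by rewrite !sumrB !sag -!mulr_suml sa !mul0r !subr0.
  rewrite (bigD1 ord0) // (bigD1 j) //= big1 => [|i /andP[i0 ij]]; last first.
    by rewrite generic // subrr mulr0.
  move=> at0; exists (m, t) => i /=; rewrite /e.
  have [->|i0] := eqVneq i ord0.
    rewrite eq_sym (negPf j0) /t /=.
    have -> : g ord0 j - g ord0 ord0 =
        m + a ord0 * (g ord0 j - g ord0 ord0 - m) / a ord0.
      by field; exact: a0.
    have -> : a ord0 * (g ord0 j - g ord0 ord0 - m) =
        - (a j * (g j j - g j ord0 - m)).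
      by apply/eqP; rewrite -addr_eq0 -[X in _ == X]at0 addr0.
    by field; exact: a0.
  have [ij|ij] := eqVneq i j; last by rewrite generic //=; ring.
  by rewrite ij /t /=; field; rewrite !a0.
have [mt mtP] := fin_all_exists column.
pose j1 : 'I_n.+2 := lift ord0 ord0.
have tE j : j != ord0 -> (mt j).2 = (mt j1).2.
  move=> j0; have [->//|jj1] := eqVneq j j1.
  have [p] : exists p, p \notin [:: ord0; j; j1].
    by apply: exists_notin; rewrite card_ord.
  rewrite !inE !negb_or => /and3P[p0 pj pj1].
  have := quad p ord0 j j1.
  rewrite /= !inE !negb_or p0 pj pj1 jj1 eq_sym j0 /= => /(_ isT).
  have gE i k : g i k = g i ord0 + (mt k).1 + (mt k).2 * (e i k - e i ord0).
    by rewrite -addrA -mtP; ring.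
  rewrite !(gE _ j) !(gE _ j1) /e (negPf p0) (negPf pj) (negPf pj1) eqxx.
  rewrite [ord0 == j]eq_sym (negPf j0) /= => H.
  have /eqP : ((mt j).2 - (mt j1).2) / a ord0 = 0.
    move/eqP: H; rewrite -subr_eq0 => /eqP H; rewrite -[RHS]H; ring.
  by rewrite mulf_eq0 invr_eq0 (negPf (a0 _)) orbF subr_eq0 => /eqP.
exists (mt j1).2, (fun i => g i ord0 - (mt j1).2 * e i ord0), (fun j => (mt j).1).
move=> i j; rewrite -/(e i j).
have [->|j0] := eqVneq j ord0.
  have := mtP ord0 ord0; rewrite !subrr mulr0 addr0 => <-; ring.
have := mtP j i; rewrite tE // => H.
have -> : g i j = (g i j - g i ord0) + g i ord0 by ring.
rewrite H; ring.
Qed.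

Section Duality.
Variables (R : realType) (n : nat).
Implicit Types (A B : 'I_n.+2 -> 'rV[R]_n) (a b : 'I_n.+2 -> R).

(** If c were 0, then every A_i would have the same product with B_j - B_0, and
    all the B_j would coincide. *)
Lemma dual_gram A B a : (2 <= n)%N -> degenerate_simplex A ->
  is_dual A B -> is_stress A a ->
  exists c u v, c != 0 /\
    forall i j, dot (A i) (B j) = u i + v j + c * ((i == j)%:R / a i).
Proof.
move=> hn dA [dB AB] [a0 aA sa].
have [||c [u [v gE]]] :=
  @quadrangle_gram R n (fun i j => dot (A i) (B j)) a hn a0 sa.
- by move=> j; rewrite -dot_suml aA /dot mul0mx mxE.
- move=> i j k l /AB; rewrite dotBl !dotBr => /eqP.
  by rewrite subr_eq0 => /eqP.
exists c, u, v; split=> //; apply/eqP => c0.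
apply: (simplex_vertices_differ (O := B ord0) (ltnW hn) dB) => j.
suff : (B j - B ord0)^T = 0 by rewrite -[0]trmx0 => /trmx_inj/subr0_eq.
apply: (affine_const_on_vertices_eq0 (z := const_mx (v j - v ord0)) dA).
apply/matrixP => i k; rewrite !ord1.
transitivity (dot (A i) (B j - B ord0)).
  by rewrite /dot !mxE; apply: eq_bigr => l _; rewrite !mxE.
by rewrite dotBr !gE c0 !mul0r !mxE big_ord1 !mxE; ring.
Qed.

Section Gram.
Variables (A B : 'I_n.+2 -> 'rV[R]_n) (a : 'I_n.+2 -> R).
Variables (c : R) (u v : 'I_n.+2 -> R).
Hypotheses (c0 : c != 0) (sA : is_stress A a).
Hypothesis gE :
  forall i j, dot (A i) (B j) = u i + v j + c * ((i == j)%:R / a i).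

(** Summing the formula for A_i . B_j over j with the weights b kills u_i and
    leaves b_i / a_i independent of i. *)
Lemma dual_stress b : is_stress B b -> exists2 l, l != 0 & forall i, b i = l * a i.
Proof.
move=> [b0 bB sb]; have [a0 _ _] := sA.
pose l := - (\sum_j b j * v j) / c.
have bE i : b i = l * a i.
  have : \sum_j b j * dot (B j) (A i) = 0 by rewrite -dot_suml bB /dot mul0mx mxE.
  under eq_bigr => j _ do rewrite dotC gE 2!mulrDr.
  rewrite !big_split /= -mulr_suml sb mul0r add0r [X in _ + X](bigD1 i) //= eqxx.
  rewrite [X in _ + (_ + X)]big1 => [|j ji]; last first.
    by rewrite eq_sym (negPf ji) mul0r !mulr0.
  move=> /eqP; rewrite addr0 addr_eq0 /l => /eqP ->.
  by rewrite /=; field; rewrite c0 a0.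
exists l => //; apply/eqP => l0.
by have := b0 ord0; rewrite bE l0 mul0r eqxx.
Qed.

Lemma gram_weights :
  vertex_mx A *m (vertex_mx B)^T *m weights a =
  (\col_i u i) *m ((ones R n)^T *m weights a) +
  ones R n *m (\row_j (v j * a j)) + c%:M.
Proof.
have [a0 _ _] := sA.
apply/matrixP => i j; rewrite weights_ones mul_mx_diag !mxE !big_ord1 !mxE.
have -> : \sum_k vertex_mx A i k * (vertex_mx B)^T k j = dot (A i) (B j).
  by rewrite dotE; apply: eq_bigr => k _; rewrite !mxE.
rewrite gE; case: eqP => [<-|_] /=; field; exact: a0.
Qed.

(** Both sides act on the A_i in the same way up to a constant vector, since
    the terms u_i and v_j of the Gram matrix contribute 0 and a vector
    independent of i. *)
Lemma dual_mixed_tensor : degenerate_simplex A ->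
  (vertex_mx B)^T *m weights a *m vertex_mx A = c%:M.
Proof.
move=> dA; apply/eqP; rewrite -subr_eq0; apply/eqP.
apply: (affine_const_on_vertices_eq0 (z := (\row_j (v j * a j)) *m vertex_mx A) dA).
rewrite mulmxBr !mulmxA gram_weights !mulmxDl -2!mulmxA (stress_vertex_mx sA).
by rewrite mulmx0 add0r mulmxA mul_scalar_mx mul_mx_scalar addrK.
Qed.

(** In A^T D (A B^T D) B the terms u_i and v_j of A B^T are killed by the stress
    equations of B and of A, so that c A^T D B remains. *)
Lemma dual_tensor : degenerate_simplex A -> is_stress B a ->
  stress_tensor A a *m stress_tensor B a = (c ^+ 2)%:M.
Proof.
move=> dA sB.
have AWo : (vertex_mx A)^T *m weights a *m ones R n = 0.
  apply: trmx_inj; rewrite !trmx_mul trmxK weights_tr mulmxA trmx0.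
  exact: stress_vertex_mx sA.
have AWB : (vertex_mx A)^T *m weights a *m vertex_mx B = c%:M.
  apply: trmx_inj; rewrite tr_scalar_mx !trmx_mul trmxK weights_tr mulmxA.
  exact: dual_mixed_tensor.
rewrite /stress_tensor.
transitivity ((vertex_mx A)^T *m weights a *m
  (vertex_mx A *m (vertex_mx B)^T *m weights a) *m vertex_mx B).
  by rewrite !mulmxA.
rewrite gram_weights !mulmxDr !mulmxDl !mulmxA AWo !mul0mx addr0.
rewrite -(mulmxA _ _ (weights a)) -(mulmxA _ _ (vertex_mx B)).
rewrite (stress_vertex_mx sB) mulmx0 add0r.
by rewrite mul_mx_scalar -scalemxAl AWB scale_scalar_mx expr2.
Qed.

(** For a point O = sum_j g_j A_j with sum_j g_j = 0, the formula for A_j . B_i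
    makes O . B_i a constant plus c g_i / a_i. Choosing g_i so that this is
    |B_i|^2 / 2 removes the dependence on i from |B_i - O|^2; the hypothesis is
    exactly that these g_j sum to 0. *)
Lemma dual_equidistant :
  \sum_i a i * dot (B i) (B i) = 0 ->
  exists O s, forall i, dot (B i - O) (B i - O) = s.
Proof.
move=> aBB; have [a0 _ _] := sA.
pose g j := a j * dot (B j) (B j) / (c *+ 2).
pose O := \sum_j g j *: A j.
exists O, (dot O O - \sum_j g j * u j *+ 2) => i.
have sg : \sum_j g j = 0 by rewrite -mulr_suml aBB mul0r.
have OB : dot O (B i) = \sum_j g j * u j + dot (B i) (B i) / 2.
  rewrite dot_suml; under eq_bigr => j _ do rewrite gE 2!mulrDr.
  rewrite !big_split /= -mulr_suml sg mul0r addr0 [X in _ + X](bigD1 i) //= eqxx.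
  rewrite [X in _ + (_ + X)]big1 => [|j ji]; last first.
    by rewrite (negPf ji) mul0r !mulr0.
  by rewrite addr0 /g; congr (_ + _); rewrite /=; field; rewrite c0 a0.
by rewrite dotBl !dotBr (dotC (B i) O) OB sumrMnl; field.
Qed.
End Gram.
End Duality.

Theorem theorem1p3 (R : realType) (n : nat) (hn : (2 <= n)%N)
    (A B : 'I_n.+2 -> 'rV[R]_n) (alpha beta : 'I_n.+2 -> R)
    (hA : degenerate_simplex A) (hB : is_dual A B)
    (halpha : is_stress A alpha) (hbeta : is_stress B beta)
    (P Q P' Q' : 'rV[R]_n) :
  (stress_invariant A alpha P Q (n - 1)%N = 0 <->
   stress_invariant B beta P' Q' 1%N = 0) /\
  (stress_invariant B beta P' Q' 1%N = 0 <-> cospherical B).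
Proof.
have n_gt0 : (0 < n)%N := ltnW hn.
have [c [u [v [c0 gE]]]] := dual_gram hn hA hB halpha.
have [l l0 bE] := dual_stress c0 halpha gE hbeta.
have [[a0 _ sa] [_ bB _]] := (halpha, hbeta).
(* Hence the tensors of A and B can be formed with the same weights. *)
have sB : is_stress B alpha.
  split=> //; apply: (scalerI l0); rewrite scaler0 -[RHS]bB scaler_sumr.
  by apply: eq_bigr => i _; rewrite bE scalerA.
have c1E : stress_invariant B beta P' Q' 1 = l * \tr (stress_tensor B alpha).
  rewrite (stress_invariant_coef P' Q' _ hbeta) coef1_det_1addX.
  rewrite (stress_tensor_trace 0 hbeta) (stress_tensor_trace 0 sB) mulr_sumr.
  by apply: eq_bigr => i _; rewrite bE mulrA.
have c1_eq0 : stress_invariant B beta P' Q' 1 = 0 <->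
    \tr (stress_tensor B alpha) = 0.
  rewrite c1E; split=> [/eqP|->]; last by rewrite mulr0.
  by rewrite mulf_eq0 (negPf l0) => /eqP.
split; rewrite c1_eq0.
  pose T' := (c ^+ 2)^-1 *: stress_tensor B alpha.
  have TT' : stress_tensor A alpha *m T' = 1%:M.
    rewrite -scalemxAr (dual_tensor halpha gE) // scale_scalar_mx.
    by rewrite mulVf ?expf_neq0.
  have dT' : \det T' != 0.
    by rewrite -unitfE -unitmxE; have [] := mulmx1_unit TT'.
  have := coef_pred_det_1addX n_gt0 TT'.
  rewrite -(stress_invariant_coef P Q _ halpha) -subn1 mxtraceZ => cE.
  split=> [c00 | t0].
    move/eqP: cE; rewrite c00 mul0r eq_sym mulf_eq0 invr_eq0 expf_eq0 /=.
    by rewrite (negPf c0) => /eqP.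
  by apply/eqP; move/eqP: cE; rewrite t0 mulr0 mulf_eq0 (negPf dT') orbF.
split=> [t0 | [O [r [_ dr]]]].
  have [|O [s sE]] := dual_equidistant c0 halpha gE.
    rewrite -[RHS]t0 (stress_tensor_trace 0 sB).
    by apply: eq_bigr => i _; rewrite subr0.
  exists O, (Num.sqrt s); split=> [|i]; last by rewrite /dist sE.
  (* A zero radius would put all the vertices at O. *)
  rewrite sqrtr_gt0 lt_def -(sE ord0) dot_ge0 andbT; apply/eqP => s0.
  case: hB => dB _; apply: (simplex_vertices_differ (O := O) n_gt0 dB) => i.
  by apply/eqP; rewrite -subr_eq0 -dot_eq0 sE -(sE ord0) s0.
rewrite (stress_tensor_trace O sB).
have dE i : dot (B i - O) (B i - O) = r ^+ 2.
  by rewrite -(dr i) /dist sqr_sqrtr ?dot_ge0.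
by under eq_bigr => i _ do rewrite dE; rewrite -mulr_suml sa mul0r.
Qed.
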